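(* Let $n,d$ be integers such that $1\le d\le n$. The map $\mathcal{M}_{n,d}$ is a bijection from $\mathrm{SYT}(d,1^{n-d})$ to the set of Schröder paths $\widetilde{\mathrm{Sch}}_{n,d-1,(0)}$, with inverse $\mathcal{R}_{n,d}$. Moreover $\mathrm{maj}(\tau)=\mathrm{bounce}(\mathcal{M}_{n,d}(\tau))$ for all $\tau\in\mathrm{SYT}(d,1^{n-d})$ and $\mathrm{maj}(\mathcal{R}_{n,d}(\gamma))=\mathrm{bounce}(\gamma)$ for all $\gamma\in\widetilde{\mathrm{Sch}}_{n,d-1,(0)}$.
   Context: Words in $N=(0,1)$, $E=(1,0)$, $D=(1,1)$ are read as lattice paths starting at $(0,0)$. $\mathrm{Sch}_{n,d}$ is the set of Schröder paths with $d$ diagonal steps: words with $n-d$ $N$'s, $n-d$ $E$'s and $d$ $D$'s with $|\omega|_N\ge|\omega|_E$ for every prefix $\omega$. A Dyck path is a Schröder path without $D$. The area of a Schröder path is the number of lower triangles (lower halves of unit squares cut along the diagonal from bottom left to top right corner) under the path and above the main diagonal; equivalently the sum of $y-x$ over all $N$ and $D$ steps, $(x,y)$ being the starting point of the step. $\widetilde{\mathrm{Sch}}_{n,d,(0)}$ is the set of $\gamma\in\mathrm{Sch}_{n,d}$ ending with the factor $NE$ and having area $0$; equivalently the words $\gamma=\gamma_1\gamma_2\cdots\gamma_n$ with each $\gamma_i\in\{NE,D\}$, $\gamma_n=NE$, and exactly $d$ blocks equal to $D$. The sequence $(\gamma_1,\dots,\gamma_n)$ is called $\mathrm{Touch}(\gamma)$.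 Bounce: for a Dyck path of size $k$ ($k$ north steps), the bounce path starts at $(0,0)$, goes north until it reaches the starting point of an east step of the Dyck path, then east until it reaches the main diagonal, then north again, and so on until $(k,k)$; its bounce is the sum of $k-j$ over all points $(j,j)$, $1\le j\le k$, at which the bounce path returns to the main diagonal. For a Schröder path $\gamma$, let $\Gamma(\gamma)$ be the Dyck path obtained by deleting all $D$ steps. The points where the bounce path of $\Gamma(\gamma)$ turns from north to east are starting points of east steps of $\Gamma(\gamma)$; the corresponding east steps of $\gamma$ are the peak steps. $\mathrm{numph}(\gamma)$ is the sum over all $D$ steps of the number of peak steps preceding that $D$ step in the word, and $\mathrm{bounce}(\gamma)=\mathrm{bounce}(\Gamma(\gamma))+\mathrm{numph}(\gamma)$. $\mathrm{SYT}(\lambda)$: standard Young tableaux of shape $\lambda$ (French notation). $\mathrm{Des}(\tau)$ is the set of entries $i$ with $i+1$ in a strictly higher row; $\mathrm{maj}(\tau)$ is the sum of the elements of $\mathrm{Des}(\tau)$. A tableau in $\mathrm{SYT}(d,1^{n-d})$ is determined by its descent set, which can be any $(n-d)$-subset of $\{1,\dots,n-1\}$. $\mathcal{M}_{n,d}:\mathrm{SYT}(d,1^{n-d})\to\widetilde{\mathrm{Sch}}_{n,d-1,(0)}$ sends $\tau$ to $\gamma_1\cdots\gamma_n$ with $\gamma_n=NE$ and, for $1\le i\le n-1$, $\gamma_{n-i}=NE$ if $i\in\mathrm{Des}(\tau)$ and $\gamma_{n-i}=D$ otherwise. $\mathcal{R}_{n,d}:\widetilde{\mathrm{Sch}}_{n,d-1,(0)}\to\mathrm{SYT}(d,1^{n-d})$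 sends $\gamma$ to the tableau with descent set $\{n-i : 1\le i\le n-1,\ \gamma_i=NE\in\mathrm{Touch}(\gamma)\}$. *)

(* Defs.v *)
From HB Require Import structures.
From mathcomp Require Import all_boot.
From mathcomp Require Import boolp classical_sets functions.

Set Implicit Arguments.
Unset Strict Implicit.
Unset Printing Implicit Defensive.

Local Open Scope nat_scope.
Local Open Scope classical_set_scope.

(* Steps (0,1), (1,0) and (1,1). *)
Inductive step := Nst | Est | Dst.

Definition eq_step (a b : step) : bool :=
  match a, b with
  | Nst, Nst | Est, Est | Dst, Dst => true
  | _, _ => false
  end.

Lemma eq_stepP : Equality.axiom eq_step.
Proof. by do 2!case; constructor. Qed.

HB.instance Definition _ := hasDecEq.Build step eq_stepP.

Definition word := seq step.

Definition endpoint (w : word) : nat * nat :=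
  (count_mem Est w + count_mem Dst w, count_mem Nst w + count_mem Dst w).

(* Steps are indexed from 0; [step_at w p] is meaningful for [p < size w]. *)
Definition step_at (w : word) (p : nat) : step := nth Nst w p.

Definition start_point (w : word) (p : nat) : nat * nat := endpoint (take p w).

Definition Sch (n d : nat) : set word :=
  [set w | [/\ count_mem Nst w = n - d,
               count_mem Est w = n - d,
               count_mem Dst w = d
             & forall p, count_mem Est (take p w) <= count_mem Nst (take p w)]].

(* On Schröder paths [y >= x] at every point, so the subtraction on [nat] is
   the true difference. *)
Definition area (w : word) : nat :=
  \sum_(p < size w | step_at w p != Est)
    ((start_point w p).2 - (start_point w p).1).

Definition SchTilde0 (n d : nat) : set word :=
  [set w | [/\ Sch n d w, suffix [:: Nst; Est] w & area w = 0]].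

(* On a path of [SchTilde0 n d] the parsing consumes the whole word; blocks are
   numbered from 1 in the maps below, so block [i] is the entry of index
   [i.-1]. *)
Fixpoint Touch (w : word) : seq word :=
  match w with
  | Nst :: Est :: w' => [:: Nst; Est] :: Touch w'
  | Dst :: w' => [:: Dst] :: Touch w'
  | _ => [::]
  end.

Definition east_starts (w : word) : seq (nat * nat) :=
  [seq start_point w p | p <- iota 0 (size w) & step_at w p == Est].

(* Height at which the vertical line going up from [(j, j)] first meets the
   starting point of an east step of the Dyck path [w]. *)
Definition north_run (w : word) (j : nat) : nat :=
  j + find (fun y => (j, y) \in east_starts w) (iota j (count_mem Nst w).+1).

(* Points where the bounce path of the Dyck path [w] turns from north to east,
   from its visit of [(j, j)] on.  After the turn at [(j, y)] the path returns
   to the diagonal at [(y, y)].  As [y > j] on a Dyck path, its size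
   [count_mem Nst w] is enough [fuel]. *)
Fixpoint bounce_turns_from (w : word) (fuel j : nat) : seq (nat * nat) :=
  if fuel is fuel'.+1 then
    if j < count_mem Nst w then
      (j, north_run w j) :: bounce_turns_from w fuel' (north_run w j)
    else [::]
  else [::].

Definition bounce_turns (w : word) : seq (nat * nat) :=
  bounce_turns_from w (count_mem Nst w) 0.

Definition dyck_bounce (w : word) : nat :=
  \sum_(t <- bounce_turns w) (count_mem Nst w - t.2).

Definition Gamma (w : word) : word := [seq s <- w | s != Dst].

(* The step [p] of [w], if not diagonal, becomes in [Gamma w] a step starting
   at [endpoint (Gamma (take p w))]. *)
Definition peak_step (w : word) (p : nat) : bool :=
  (step_at w p == Est) &&
  (endpoint (Gamma (take p w)) \in bounce_turns (Gamma w)).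

Definition numph (w : word) : nat :=
  \sum_(p < size w | step_at w p == Dst) count (peak_step w) (iota 0 p).

Definition bounce (w : word) : nat := dyck_bounce (Gamma w) + numph w.

(* A tableau is the list of its rows from bottom to top (French notation). *)
Definition tableau := seq (seq nat).

Definition SYT (la : seq nat) : set tableau :=
  [set t | [/\ shape t = la,
               perm_eq (flatten t) (iota 1 (sumn la)),
               all (sorted ltn) t
             & forall i j, j < size (nth [::] t i.+1) ->
                 nth 0 (nth [::] t i) j < nth 0 (nth [::] t i.+1) j]].

Definition row_of (t : tableau) (i : nat) : nat := find (fun r => i \in r) t.

Definition Des (t : tableau) : seq nat :=
  [seq i <- iota 1 (size (flatten t)).-1 | row_of t i < row_of t i.+1].

Definition maj (t : tableau) : nat := \sum_(i <- Des t) i.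

Definition hook (n d : nat) : seq nat := d :: nseq (n - d) 1.

(* With [i = n - j], the block of index [j < n] is NE iff [i] is a descent. *)
Definition Mmap (n : nat) (t : tableau) : word :=
  flatten [seq if (j == n) || (n - j \in Des t) then [:: Nst; Est] else [:: Dst]
          | j <- iota 1 n].

(* [xget] picks the tableau with the prescribed descent set; the value [[::]]
   is used only if there is none. *)
Definition Rmap (n d : nat) (w : word) : tableau :=
  xget [::]
    [set t | SYT (hook n d) t /\
             Des t =i [seq n - i | i <- iota 1 n.-1
                                 & nth [::] (Touch w) i.-1 == [:: Nst; Est]]].

(* Main.v *)
(* A path of area 0 ending with NE is a concatenation of n blocks NE or D, the
   last one being NE, and a tableau of hook shape is determined by its descent
   set, so that both sides are encoded by the same subset of {1, ..., n - 1}: the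
   entry i is a descent iff the block n - i is NE.  Deleting the D steps leaves
   the staircase (NE)^k, whose bounce path is itself; hence every east step is a
   peak step, and a block NE contributes to the bounce the number of blocks after
   it, which for the block n - i is i. *)
Require Import Defs.
From mathcomp Require Import all_boot.
From mathcomp Require Import boolp classical_sets functions.
From mathcomp Require Import zify.

(** * Words made of blocks NE and D, encoded by bits *)

Definition block (x : bool) : word := if x then [:: Nst; Est] else [:: Dst].

Definition blocks (b : bitseq) : word := flatten [seq block x | x <- b].

Lemma blocks_cons x b : blocks (x :: b) = block x ++ blocks b.
Proof. by []. Qed.

Lemma blocks_rcons b x : blocks (rcons b x) = blocks b ++ block x.
Proof. by rewrite /blocks map_rcons flatten_rcons. Qed.

Lemma Touch_blocks b : Touch (blocks b) = [seq block x | x <- b].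
Proof. by elim: b => //= -[] b IH /=; rewrite -/(blocks b) IH. Qed.

Lemma Gamma_blocks b : Gamma (blocks b) = blocks (nseq (count id b) true).
Proof.
elim: b => // x b IH; rewrite blocks_cons /Gamma filter_cat -/(Gamma (blocks b)) IH.
by case: x.
Qed.

Lemma count_Nst_blocks b : count_mem Nst (blocks b) = count id b.
Proof. by elim: b => //= x b IH; rewrite count_cat -/(blocks b) IH; case: x. Qed.

Lemma count_Est_blocks b : count_mem Est (blocks b) = count id b.
Proof. by elim: b => //= x b IH; rewrite count_cat -/(blocks b) IH; case: x. Qed.

Lemma count_Dst_blocks b : count_mem Dst (blocks b) = count negb b.
Proof. by elim: b => //= x b IH; rewrite count_cat -/(blocks b) IH; case: x. Qed.

(** * The bounce path of the staircase *)

Lemma start_point_cons s w p :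
  start_point (s :: w) p.+1 =
  ((s != Nst) + (start_point w p).1, (s != Est) + (start_point w p).2).
Proof. by rewrite /start_point /endpoint /=; case: s => /=; congr pair; lia. Qed.

(** Prepending a step translates all later starting points by its displacement, written here with
    booleans; an E step in front also starts at the origin. *)
Lemma east_starts_cons s w :
  east_starts (s :: w) = nseq (s == Est) (0, 0) ++
    [seq ((s != Nst) + q.1, (s != Est) + q.2) | q <- east_starts w].
Proof.
rewrite /east_starts /= (iotaDl 1 0) filter_map -!map_comp.
rewrite -(eq_map (start_point_cons s w)).
by case: s; rewrite /= -map_comp.
Qed.

Lemma east_starts_staircase k :
  east_starts (blocks (nseq k true)) = [seq (j, j.+1) | j <- iota 0 k].
Proof.
elim: k => // k IH; rewrite [nseq _ _]/= blocks_cons /= !east_starts_cons IH /=.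
by rewrite (iotaDl 1 0) -!map_comp.
Qed.

Lemma north_run_staircase k j :
  j < k -> north_run (blocks (nseq k true)) j = j.+1.
Proof.
move=> ltjk; rewrite /north_run east_starts_staircase count_Nst_blocks.
rewrite count_nseq mul1n.
(* The vertical line through [(j, j)] carries a single east start, one unit above the diagonal, so
   the search stops at its second candidate. *)
have mem_j y : ((j, y) \in [seq (i, i.+1) | i <- iota 0 k]) = (y == j.+1).
  apply/mapP/eqP => [[i _ [-> ->]] // | ->].
  by exists j; rewrite // mem_iota.
rewrite (eq_find mem_j); case: k ltjk {mem_j} => // k _ /=.
by rewrite ltn_eqF // eqxx addn1.
Qed.

Lemma bounce_turns_staircase k :
  bounce_turns (blocks (nseq k true)) = [seq (j, j.+1) | j <- iota 0 k].
Proof.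
rewrite /bounce_turns count_Nst_blocks count_nseq mul1n.
(* From [(j, j)] the staircase has [k - j] turns left, so keeping [j + f = k] makes the fuel run out
   exactly at the end of the path. *)
suff turns f j : j + f = k ->
    bounce_turns_from (blocks (nseq k true)) f j = [seq (i, i.+1) | i <- iota j f].
  exact: turns.
elim: f j => // f IH j jfk /=.
have ltjk : j < k by lia.
rewrite count_Nst_blocks count_nseq mul1n ltjk north_run_staircase // IH //; lia.
Qed.

Lemma dyck_bounce_staircase k :
  dyck_bounce (blocks (nseq k true)) = 'C(k, 2).
Proof.
rewrite /dyck_bounce bounce_turns_staircase big_map count_Nst_blocks count_nseq.
(* The summands [k - j.+1] are [0, ..., k - 1] in reverse order. *)
rewrite mul1n -bin2_sum big_nat_rev /= /index_iota subn0.
by apply: eq_bigr => j _; rewrite add0n.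
Qed.

(** * Peak steps and the bounce of a block word *)

(** The witness [j] is the number of NE blocks before the one containing this E; the N of the same
    block accounts for the extra unit of height. *)
Lemma Gamma_take_Est b p :
  step_at (blocks b) p = Est ->
  exists2 j, j < count id b & endpoint (Gamma (take p (blocks b))) = (j, j.+1).
Proof.
elim: b p => [|[] b IH] p; first by rewrite /step_at nth_nil.
  case: p => [|[|p]] //; first by exists 0.
  move=> /IH[j ltj [e1 e2]]; exists j.+1 => //.
  rewrite /endpoint /= -/(blocks b) -/(Gamma (take p (blocks b))).
  congr pair; lia.
by case: p => [|p] // /IH.
Qed.

Lemma peak_step_blocks b p :
  peak_step (blocks b) p = (step_at (blocks b) p == Est).
Proof.
rewrite /peak_step; case: eqP => //= /Gamma_take_Est[j ltj ->].
rewrite Gamma_blocks bounce_turns_staircase.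
by apply/mapP; exists j; rewrite // mem_iota.
Qed.

(** This is [numph] with all E steps taken as peaks. Unlike [numph], it does not refer to the bounce
    path of the whole word, so it can be computed letter by letter. *)
Definition east_diag_pairs (w : word) : nat :=
  \sum_(p < size w | step_at w p == Dst) count_mem Est (take p w).

Lemma east_diag_pairs_cons s w :
  east_diag_pairs (s :: w) = (s == Est) * count_mem Dst w + east_diag_pairs w.
Proof.
rewrite /east_diag_pairs big_mkcond big_ord_recl /= if_same add0n.
rewrite -big_mkcond /= big_split /= sum_nat_const mulnC; congr (_ * _ + _).
rewrite -sum1_card -sum1_count (big_nth Nst) big_mkord.
by apply: eq_bigl => i.
Qed.

Lemma numph_blocks b : numph (blocks b) = east_diag_pairs (blocks b).
Proof.
apply: eq_bigr => p _; rewrite (eq_count (peak_step_blocks b)).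
rewrite -(@map_nth_iota0 _ Nst) ?count_map // ltnW //.
Qed.

(* An NE block in front contributes to the bounce the number of NE blocks after
   it (through the bounce path) and the number of D blocks after it (through
   [numph]). *)
Lemma bounce_blocks_cons x b :
  bounce (blocks (x :: b)) = x * size b + bounce (blocks b).
Proof.
rewrite /bounce !numph_blocks !Gamma_blocks !dyck_bounce_staircase.
have size_b : size b = count id b + count negb b := esym (count_predC id b).
rewrite blocks_cons; case: x => /=; rewrite !east_diag_pairs_cons //=.
(* Pascal's rule yields the number of later NE blocks; adding the later D blocks gives [size b]. *)
by rewrite count_Dst_blocks binS bin1; lia.
Qed.

Lemma bounce_blocks_nil : bounce (blocks [::]) = 0.
Proof. by rewrite /bounce /dyck_bounce /numph big_nil big_ord0. Qed.

(** * Paths of area 0 as block words *)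

Lemma blocks_prefix b p :
  count_mem Est (take p (blocks b)) <= count_mem Nst (take p (blocks b)).
Proof.
elim: b p => [|[] b IH] p //; first by case: p => [|[|p]] //=; apply: IH.
by case: p => [|p] //=; apply: IH.
Qed.

Lemma blocks_diagonal b p : step_at (blocks b) p != Est ->
  count_mem Est (take p (blocks b)) = count_mem Nst (take p (blocks b)).
Proof.
elim: b p => [|[] b IH] p //.
  by case: p => [|[|p]] //= /IH; rewrite -/(blocks b) => ->.
by case: p => [|p] //= /IH; rewrite -/(blocks b) => ->.
Qed.

(** A first step E would go below the diagonal, and a first step N leaves it, so that only E can
    follow. Thus a block splits off in front, and the rest satisfies the same hypotheses. The
    induction bounds the length because a block has one or two letters. *)
Lemma blocks_of_prefix (w : word) :
    (forall p, count_mem Est (take p w) <= count_mem Nst (take p w)) ->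
    (forall p, p < size w -> step_at w p != Est ->
       count_mem Est (take p w) = count_mem Nst (take p w)) ->
    count_mem Est w = count_mem Nst w ->
  exists b, w = blocks b.
Proof.
have [k] := ubnP (size w); elim: k w => // k IH [|[] w] sz above diag bal.
- by exists [::].
- case: w sz above diag bal => [|[] w] //= sz above diag bal.
  + by have := diag 1 isT isT.
  + have [||||b ->] := IH w; last by exists (true :: b).
    * by lia.
    * by move=> p; have := above p.+2; rewrite /=; lia.
    * by move=> p ltp sp; have /= := diag p.+2 ltp sp; lia.
    * by case: bal.
  + by have := diag 1 isT isT.
- by have := above 1; rewrite /= take0.
- have [||||b ->] := IH w; last by exists (false :: b).
  + by [].
  + by move=> p; have := above p.+1.
  + by move=> p ltp sp; have /= := diag p.+1 ltp sp; lia.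
  + by move: bal => /=; lia.
Qed.

Lemma SchTilde0_blocks n e w : e < n ->
  SchTilde0 n e w <->
  exists c, [/\ size c = n.-1, count negb c = e & w = blocks (rcons c true)].
Proof.
move=> lten; split=> [[[cN cE cD above] suf area0]|[c [sz ce ->]]].
  have [||b wb] := blocks_of_prefix w above; last 1 first.
  - case/lastP: b wb => [|c []] wb.
    + by move: suf; rewrite wb.
    + exists c; split=> //.
      * have size_c : size c = count id c + count negb c := esym (count_predC id c).
        move: cN cD; rewrite wb count_Nst_blocks count_Dst_blocks -cats1 !count_cat /=.
        by lia.
      * by move: cD; rewrite wb count_Dst_blocks -cats1 count_cat addn0.
    (* A final block D is excluded by comparing last letters with the suffix NE. *)
    + case/suffixP: suf => s; rewrite wb blocks_rcons.
      by move/(congr1 (last Nst)); rewrite !last_cat.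
  (* Area 0 makes every term [y - x] vanish; with truncated subtraction this gives [y <= x], and the
     prefix condition gives the converse. *)
  - move=> p ltp sp; apply/eqP; rewrite eqn_leq above /=.
    move/eqP: area0; rewrite /area sum_nat_eq0 => /forallP/(_ (Ordinal ltp)).
    by rewrite /= sp /start_point /endpoint /=; lia.
  - by rewrite cN cE.
have size_c : size c = count id c + count negb c := esym (count_predC id c).
split; first split.
- by rewrite count_Nst_blocks -cats1 count_cat /=; lia.
- by rewrite count_Est_blocks -cats1 count_cat /=; lia.
- by rewrite count_Dst_blocks -cats1 count_cat /= !addn0.
- by move=> p; apply: blocks_prefix.
- by rewrite blocks_rcons suffix_suffix.
- rewrite /area big1 // => p /blocks_diagonal eqp.
  by rewrite /start_point /endpoint /= eqp subnn.
Qed.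

(** * Block words indexed by subsets *)

(* [D] lists in increasing order a [k]-element subset of {1, ..., m}. *)
Definition is_subset (m k : nat) (D : seq nat) :=
  D = [seq i <- iota 1 m | i \in D] /\ size D = k.

Lemma filter_iota_id (P : pred nat) m :
  [seq i <- iota 1 m | P i] = [seq i <- iota 1 m | i \in [seq i <- iota 1 m | P i]].
Proof. by apply: eq_in_filter => i i_m; rewrite mem_filter i_m andbT. Qed.

(** Bits run from the entry [m] down to 1, as the block [n - i] encodes [i]; the last [true] is the
    forced final NE. *)
Fixpoint NE_bits (m : nat) (D : seq nat) : bitseq :=
  if m is m'.+1 then (m \in D) :: NE_bits m' D else [:: true].

Lemma size_NE_bits m D : size (NE_bits m D) = m.+1.
Proof. by elim: m => //= m ->. Qed.

Lemma nth_NE_bits m D j : j < m -> nth false (NE_bits m D) j = (m - j \in D).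
Proof. by elim: m j => // m IH [|j] //=; apply: IH. Qed.

Lemma Mmap_NE_bits m t : Mmap m.+1 t = blocks (NE_bits m (Des t)).
Proof.
rewrite /Mmap /blocks; congr flatten.
suff -> : NE_bits m (Des t) =
    [seq (j == m.+1) || (m.+1 - j \in Des t) | j <- iota 1 m.+1] by rewrite -map_comp.
elim: m => //= m ->; congr (_ :: _).
by rewrite subSS (iotaDl 1 2) -map_comp.
Qed.

(** The bit of an entry [i] is followed by exactly [i] bits, the forced one included, and the forced
    NE itself contributes 0. *)
Lemma bounce_NE_bits m D :
  bounce (blocks (NE_bits m D)) = \sum_(i <- iota 1 m | i \in D) i.
Proof.
elim: m => [|m IH]; first by rewrite big_nil bounce_blocks_cons bounce_blocks_nil.
rewrite [NE_bits _ _]/= bounce_blocks_cons IH size_NE_bits.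
rewrite -[in RHS](addn1 m) iotaD big_cat /= big_cons big_nil add1n addn0 addnC.
by case: (_ \in _); rewrite ?mul1n.
Qed.

Lemma NE_bits_rcons m D :
  NE_bits m D = rcons [seq m - j \in D | j <- iota 0 m] true.
Proof.
elim: m => //= m ->; congr (_ :: _).
by rewrite (iotaDl 1 0) -map_comp.
Qed.

(** Of the [m.+1 - e] blocks NE, the last is forced, which leaves [m - e] elements for [D]. *)
Lemma SchTilde0_NE_bits m e w : e <= m ->
  SchTilde0 m.+1 e w <-> exists2 D, is_subset m (m - e) D & w = blocks (NE_bits m D).
Proof.
move=> lem; rewrite SchTilde0_blocks //.
have count_bits D : is_subset m (size D) D ->
    count negb [seq m - j \in D | j <- iota 0 m] = m - size D.
  move=> [defD _].
  have szD : size D = count (mem D) (iota 1 m) by rewrite {1}defD size_filter.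
  have := count_predC (mem D) (iota 1 m); rewrite size_iota -szD => szC.
  rewrite -[RHS](_ : count (predC (mem D)) (iota 1 m) = _); last first.
    by rewrite -[m in RHS]szC addKn.
  (* The reflection [j -> m - j] matches bit positions with entries, so D blocks count the
     complement of [D]. *)
  have rev_iota : perm_eq (iota 1 m) [seq m - j | j <- iota 0 m].
    apply: uniq_perm; first exact: iota_uniq.
      rewrite map_inj_in_uniq ?iota_uniq // => i j.
      by rewrite !mem_iota; lia.
    move=> i; apply/idP/mapP => [|[j]].
      by rewrite mem_iota => ltim; exists (m - i); rewrite ?mem_iota; lia.
    by rewrite !mem_iota => ltjm ->; lia.
  by rewrite (permP rev_iota) !count_map.
split=> [[c [sz ce ->]]|[D [defD szD] ->]].
  pose D := [seq i <- iota 1 m | nth false c (m - i)].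
  have bits : [seq m - j \in D | j <- iota 0 m] = c.
    apply: (@eq_from_nth _ false); rewrite size_map size_iota // => j ltjm.
    rewrite (nth_map 0) ?size_iota // nth_iota // mem_filter mem_iota add0n.
    rewrite (subKn (ltnW ltjm)) subn_gt0 ltjm.
    by rewrite add1n ltnS leq_subr /= andbT.
  exists D; last by rewrite NE_bits_rcons bits.
  have subD : is_subset m (size D) D by split=> //; apply: filter_iota_id.
  split; first by case: subD.
  move: (count_bits _ subD); rewrite bits ce.
  have : size D <= m by rewrite size_filter -[m in _ <= m](size_iota 1) count_size.
  by lia.
exists [seq m - j \in D | j <- iota 0 m]; split; last by rewrite NE_bits_rcons.
  by rewrite size_map size_iota.
by rewrite count_bits ?szD ?subKn.
Qed.

(** * Standard tableaux of hook shape *)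

Lemma is_subset_sorted {m k D} : is_subset m k D -> sorted ltn D.
Proof.
by case=> -> _; apply: (sorted_filter ltn_trans); apply: iota_ltn_sorted.
Qed.

Lemma is_subset_iota {m k D} : is_subset m k D -> {subset D <= iota 1 m}.
Proof. by case=> -> _ i; rewrite mem_filter => /andP[]. Qed.

(* The hook with descent set [D]: [i.+1] lies in the column above the corner iff
   [i] is in [D].  The corner entry 1 stays in the first row as [0 \notin D]. *)
Definition hook_tableau (m : nat) (D : seq nat) : tableau :=
  [seq i <- iota 1 m.+1 | i.-1 \notin D] :: [seq [:: i.+1] | i <- D].

Lemma flatten_hook m D : flatten (hook_tableau m D) =
  [seq i <- iota 1 m.+1 | i.-1 \notin D] ++ [seq i.+1 | i <- D].
Proof. by rewrite -flatten_map1. Qed.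

(** This presents the column as the complementary filter to the first row. *)
Lemma map_succn_subset {m k D} : is_subset m k D ->
  [seq i.+1 | i <- D] = [seq i <- iota 1 m.+1 | i.-1 \in D].
Proof.
move=> subD; have sD := is_subset_sorted subD; have D_m := is_subset_iota subD.
apply: (irr_sorted_eq ltn_trans ltnn).
- by rewrite sorted_map.
- by apply: (sorted_filter ltn_trans); apply: iota_ltn_sorted.
- move=> i; rewrite mem_filter mem_iota; apply/mapP/andP => [[j jD ->]|[iD lti]].
    by rewrite jD; have := D_m _ jD; rewrite mem_iota; split=> //; lia.
  by exists i.-1; rewrite // prednK //; case/andP: lti.
Qed.

Lemma perm_flatten_hook {m k D} : is_subset m k D ->
  perm_eq (flatten (hook_tableau m D)) (iota 1 m.+1).
Proof.
move=> subD; rewrite flatten_hook (map_succn_subset subD).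
set P := fun i => i.-1 \notin D.
have -> : [seq i <- iota 1 m.+1 | i.-1 \in D] = [seq i <- iota 1 m.+1 | predC P i].
  by apply: eq_filter => i; rewrite /P /= negbK.
by have /permPl := perm_filterC P (iota 1 m.+1).
Qed.

Lemma row_of_hook {m k D i} : is_subset m k D -> i <= m ->
  row_of (hook_tableau m D) i.+1 = if i \in D then (index i D).+1 else 0.
Proof.
move=> subD lem.
rewrite /row_of -[find _ _]/(if i.+1 \in [seq i <- iota 1 m.+1 | i.-1 \notin D]
  then 0 else (find (fun r => i.+1 \in r) [seq [:: i.+1] | i <- D]).+1).
rewrite mem_filter mem_iota add1n !ltnS lem andbT; case: ifPn => //; case: ifPn => // iD _.
congr _.+1; rewrite find_map; apply: eq_find => j /=.
by rewrite inE eqSS eq_sym.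
Qed.

Lemma Des_hook {m k D} : is_subset m k D -> Des (hook_tableau m D) = D.
Proof.
move=> subD; rewrite /Des (perm_size (perm_flatten_hook subD)) size_iota.
case: (subD) => defD _; rewrite [RHS]defD; apply: eq_in_filter => i.
rewrite mem_iota; case: i => // i lti.
rewrite !(row_of_hook subD); try lia.
case: ifPn => iD; case: ifPn => // i1D.
(* In the remaining case both [i] and [i.+1] are in [D], and their rows are ordered as in the
   increasing list [D]. *)
rewrite ltnS; case: ltngtP => //.
  move/(sorted_ltn_index ltn_trans (is_subset_sorted subD) _ _ i1D iD).
  by rewrite ltnNge leqnSn.
by move=> eq_i; have := nth_index 0 i1D; rewrite -eq_i nth_index //; lia.
Qed.

Lemma size_first_row {m k D} : is_subset m k D ->
  size [seq i <- iota 1 m.+1 | i.-1 \notin D] = m.+1 - k.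
Proof.
move=> subD; have := perm_size (perm_flatten_hook subD); case: (subD) => _ szD.
by rewrite flatten_hook size_cat size_map szD size_iota => /(canRL (addnK _)).
Qed.

(** The rows above the first are singletons forming an increasing column, whose entries lowered by 1
    give [D]; the first row is then forced, being the increasing list of the other entries. *)
Lemma SYT_hook m d t : 0 < d <= m.+1 ->
  SYT (hook m.+1 d) t <-> exists2 D, is_subset m (m.+1 - d) D & t = hook_tableau m D.
Proof.
move=> /andP[d0 ledm].
have sum_hook : sumn (hook m.+1 d) = m.+1 by rewrite /= sumn_nseq; lia.
split=> [[sh perm_t rows cols]|[D subD ->]]; last first.
  have sD := is_subset_sorted subD; have D_m := is_subset_iota subD.
  have szD : size D = m.+1 - d by case: subD.
  split.
  - rewrite /shape /= (size_first_row subD) -map_comp /hook -szD; congr (_ :: _).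
      by lia.
    by elim: (D) => //= ? ? ->.
  - by rewrite sum_hook; apply: (perm_flatten_hook subD).
  - apply/andP; split; last by apply/allP => r /mapP[i _ ->].
    by apply: (sorted_filter ltn_trans); apply: iota_ltn_sorted.
  - move=> [|i] j /=.
      case eqD: (D) => [|c D'] /=; first by rewrite nth_nil.
      rewrite ltnS leqn0 => /eqP ->.
      have cD : c \in D by rewrite eqD mem_head.
      have D0 : 0 \notin D by apply/negP => /D_m; rewrite mem_iota.
      by rewrite -eqD /hook_tableau /= D0 /=; have := D_m _ cD; rewrite mem_iota; lia.
    case: (ltnP i.+1 (size D)) => lti; last first.
      by rewrite nth_default // size_map.
    rewrite !(nth_map 0) ?ltnS //=; last exact: ltnW.
    case: j => // _ /=; rewrite ltnS.
    by apply: (sorted_ltn_nth ltn_trans 0 sD); rewrite ?inE //; apply: ltnW.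
case: t sh perm_t rows cols => // r ss [szr shs] perm_t /= /andP[sr _] cols.
pose cs := [seq nth 0 c 0 | c <- ss].
have def_ss : ss = [seq [:: c] | c <- cs].
  rewrite /cs -map_comp -[LHS]map_id; apply/eq_in_map => c cs_c /=.
  have : size c \in shape ss by apply: map_f.
  by rewrite shs mem_nseq => /andP[_ /eqP]; case: c {cs_c} => [|x []].
have sz_cs : size cs = m.+1 - d by rewrite size_map -(size_map size) -/(shape ss) shs size_nseq.
move: perm_t; rewrite sum_hook [flatten _]/= def_ss flatten_map1 map_id => perm_t.
have col_lt i : i.+1 < size cs -> nth 0 cs i < nth 0 cs i.+1.
  move=> lti; have := cols i.+1 0; rewrite /= def_ss.
  by rewrite !(nth_map 0) //; [apply | apply: ltnW].
have sorted_cs : sorted ltn cs by apply/(sortedP 0).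
have mem_t i : (i \in r) || (i \in cs) = (0 < i < m.+2).
  by rewrite -mem_cat (perm_mem perm_t) mem_iota.
(* The lowest column entry lies above a positive corner. Hence all entries of [D] are positive. *)
have cs_gt1 c : c \in cs -> 1 < c.
  move=> cs_c; have cs0 : 0 < size cs by case: (cs) cs_c.
  have := cols 0 0; rewrite /= def_ss (nth_map 0) // => /(_ isT) /= head_lt.
  have r_head : 0 < nth 0 r 0.
    by have := mem_t (nth 0 r 0); rewrite mem_nth ?szr // => /esym/andP[].
  apply: (leq_trans (leq_ltn_trans r_head head_lt)).
  have /(nthP 0)[i lti <-] := cs_c; case: i lti => // i lti.
  by apply: ltnW; apply: (sorted_ltn_nth ltn_trans 0 sorted_cs).
pose D := [seq c.-1 | c <- cs].
have cs_D : cs = [seq i.+1 | i <- D].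
  rewrite /D -map_comp -[LHS]map_id; apply/eq_in_map => c /cs_gt1 /=; lia.
have mem_D i : (i \in D) = (i.+1 \in cs) by rewrite cs_D (mem_map succn_inj).
have subD : is_subset m (m.+1 - d) D.
  split; last by rewrite size_map.
  apply: (irr_sorted_eq ltn_trans ltnn).
  - by move: sorted_cs; rewrite cs_D sorted_map.
  - by apply: (sorted_filter ltn_trans); apply: iota_ltn_sorted.
  - move=> i; rewrite mem_filter mem_iota; case iD: (i \in D) => //=.
    move: iD; rewrite mem_D => iD; have := cs_gt1 _ iD; have := mem_t i.+1.
    by rewrite iD orbT; lia.
suff eq_r : r = [seq i <- iota 1 m.+1 | i.-1 \notin D].
  by exists D; rewrite // cs_D -map_comp eq_r.
apply: (irr_sorted_eq ltn_trans ltnn) => // [|i].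
  by apply: (sorted_filter ltn_trans); apply: iota_ltn_sorted.
rewrite mem_filter mem_iota mem_D add1n.
have := perm_uniq perm_t; rewrite iota_uniq cat_uniq => /and3P[_ /hasPn disj _].
(* The value 0 is treated apart because [i.-1.+1 = i] fails there. *)
case: i => [|i]; first by have := mem_t 0; case: (0 \in r) => //=; rewrite andbF.
rewrite -mem_t /=; case ir: (i.+1 \in r) => /=; last by case: (_ \in cs).
by rewrite andbT; apply/esym/negP => /disj /=; rewrite ir.
Qed.

(** * The two maps on the common encoding *)

Lemma NE_blocks_descents {m k D} : is_subset m k D ->
  [seq m.+1 - i | i <- iota 1 m
     & nth [::] (Touch (blocks (NE_bits m D))) i.-1 == [:: Nst; Est]] =i D.
Proof.
move=> subD; have D_m := is_subset_iota subD.
have is_NE i : 0 < i <= m ->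
    (nth [::] (Touch (blocks (NE_bits m D))) i.-1 == [:: Nst; Est]) = (m.+1 - i \in D).
  case: i => // i ltim; rewrite Touch_blocks (nth_map false); last first.
    by rewrite size_NE_bits; lia.
  by rewrite nth_NE_bits // subSS; case: (m - i \in D).
move=> j; apply/mapP/idP => [[i]|jD].
  by rewrite mem_filter mem_iota => /andP[NEi lei] ->; rewrite -is_NE //; lia.
have := D_m _ jD; rewrite mem_iota => lej; exists (m.+1 - j); last by lia.
by rewrite mem_filter mem_iota is_NE ?subKn ?jD; lia.
Qed.

(** The choice made by [xget] is determined: a hook tableau is built from its descent set, and
    increasing lists with the same members are equal. *)
Lemma Rmap_NE_bits m d D : 0 < d <= m.+1 -> is_subset m (m.+1 - d) D ->
  Rmap m.+1 d (blocks (NE_bits m D)) = hook_tableau m D.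
Proof.
move=> dm subD; apply: xget_unique => /=.
  split; first by apply/SYT_hook => //; exists D.
  by move=> i; rewrite (Des_hook subD) (NE_blocks_descents subD).
move=> t [/(SYT_hook _ _ _ dm)[D' subD' ->]].
rewrite (Des_hook subD') => eqD; congr hook_tableau.
apply: (irr_sorted_eq ltn_trans ltnn); rewrite ?(is_subset_sorted subD) //.
  exact: is_subset_sorted subD'.
by move=> i; rewrite eqD (NE_blocks_descents subD).
Qed.

Theorem proposition7 (n d : nat) (hd : 1 <= d <= n) :
  [/\ set_bij (SYT (hook n d)) (SchTilde0 n d.-1) (Mmap n),
      set_fun (SchTilde0 n d.-1) (SYT (hook n d)) (Rmap n d),
      (forall t, SYT (hook n d) t -> Rmap n d (Mmap n t) = t)
    & (forall w, SchTilde0 n d.-1 w -> Mmap n (Rmap n d w) = w)] /\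
  (forall t, SYT (hook n d) t -> maj t = bounce (Mmap n t)) /\
  (forall w, SchTilde0 n d.-1 w -> maj (Rmap n d w) = bounce w).
Proof.
case: n hd => [|m] dm; first by case: d dm.
have SYTP t := SYT_hook m d t dm.
have led : d.-1 <= m by lia.
(* As [d] is positive the two sizes agree, so tableaux and paths are parametrized by the same
   subsets [D]. *)
have szE : m - d.-1 = m.+1 - d by lia.
have SchP w := SchTilde0_NE_bits m d.-1 w led; rewrite szE in SchP.
have funM : set_fun (SYT (hook m.+1 d)) (SchTilde0 m.+1 d.-1) (Mmap m.+1).
  move=> t /= /SYTP[D subD ->]; apply/SchP; exists D => //.
  by rewrite Mmap_NE_bits (Des_hook subD).
have funR : set_fun (SchTilde0 m.+1 d.-1) (SYT (hook m.+1 d)) (Rmap m.+1 d).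
  move=> w /= /SchP[D subD ->]; apply/SYTP; exists D => //.
  by rewrite Rmap_NE_bits.
have MK t : SYT (hook m.+1 d) t -> Rmap m.+1 d (Mmap m.+1 t) = t.
  by case/SYTP=> D subD ->; rewrite Mmap_NE_bits (Des_hook subD) Rmap_NE_bits.
have RK w : SchTilde0 m.+1 d.-1 w -> Mmap m.+1 (Rmap m.+1 d w) = w.
  by case/SchP=> D subD ->; rewrite Rmap_NE_bits // Mmap_NE_bits (Des_hook subD).
have majM t : SYT (hook m.+1 d) t -> maj t = bounce (Mmap m.+1 t).
  case/SYTP=> D subD ->; rewrite Mmap_NE_bits bounce_NE_bits /maj (Des_hook subD).
  by case: subD => defD _; rewrite [in LHS]defD big_filter.
split; [split=> //; split=> // | split=> // w Sw].
- by move=> t u /set_mem St /set_mem Su eqM; rewrite -(MK t St) eqM MK.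
- by move=> w Sw; exists (Rmap m.+1 d w); [apply: funR | apply: RK].
- by rewrite majM ?RK //; apply: funR.
Qed.
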